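(* There is no algorithm which, given a finite set $S$ of finitely presented local polynomial maps on $\mathbb{Z}^{\mathbb{N}}$ and a finitely supported point $x\in\mathbb{Z}^{\mathbb{N}}$, decides whether $x$ is $S$-stable. This remains true even when $S=\{F\}$ is a singleton; that is, there is no algorithm which, given a single finitely presented local polynomial map $F$ on $\mathbb{Z}^{\mathbb{N}}$ and a finitely supported point $x\in\mathbb{Z}^{\mathbb{N}}$, decides whether $x$ is $\{F\}$-stable.
   Context: For each integer $r\ge1$ a computable bijection $\iota_r:\mathbb{Z}\times\{1,\dots,r\}\to\mathbb{N}$ is fixed once and for all, such that both maps $(r,i,j)\mapsto\iota_r(i,j)$ and $(r,n)\mapsto\iota_r^{-1}(n)$ are computable. A finitely presented local polynomial map on $\mathbb{Z}^{\mathbb{N}}$ is specified by finite data $(r,R,P_1,\dots,P_r)$, where $r\ge1$ and $R\ge0$ are integers and $P_j\in\mathbb{Z}[Y_{u,h}:-R\le u\le R,\ 1\le h\le r]$ for $1\le j\le r$. It defines the map $F:\mathbb{Z}^{\mathbb{N}}\to\mathbb{Z}^{\mathbb{N}}$ given by $$F_{\iota_r(i,j)}(x)=P_j\bigl(x_{\iota_r(i+u,h)}:-R\le u\le R,\ 1\le h\le r\bigr)$$ for every $i\in\mathbb{Z}$ and $1\le j\le r$. Each $P_j$ is encoded as a finite list of monomials, each given by its integer coefficient and exponent vector, so that $(r,R,P_1,\dots,P_r)$ is a finite string; maps are given to an algorithm in this form. (Different maps in $S$ may have different $r$ and $R$.) A point $x=(x_n)\in\mathbb{Z}^{\mathbb{N}}$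 is finitely supported if $x_n=0$ for all but finitely many $n$; such a point is given to an algorithm as the finite list of its nonzero coordinates with their indices. For a finite collection $S$ of such maps, the $S$-orbit of $x\in\mathbb{Z}^{\mathbb{N}}$ is $\mathcal{O}_S(x)=\{F_k\circ\cdots\circ F_1(x):k\ge0,\ F_i\in S\}$, and $x$ is $S$-stable if $\mathcal{O}_S(x)$ is a finite set. *)

(* Defs.v *)
From Stdlib Require List.
From mathcomp Require Import all_boot all_order all_algebra.
From mathcomp Require Import finmap mpoly.
From mathcomp Require Import classical_sets cardinality.

Set Implicit Arguments.
Unset Strict Implicit.
Unset Printing Implicit Defensive.

Import GRing.Theory.
Local Open Scope ring_scope.

(* Algorithms are Kleene's mu-recursive (partial recursive) functions; by the
   Church-Turing thesis any other standard model gives the same notion. *)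
Inductive murec : nat -> Type :=
| mr_zero : murec 0
| mr_succ : murec 1
| mr_proj n (i : 'I_n) : murec n
| mr_comp m n (f : murec m) (g : 'I_m -> murec n) : murec n
| mr_prec n (f : murec n) (g : murec n.+2) : murec n.+1
| mr_mu n (f : murec n.+1) : murec n.

(* [mr_eval c v y]: the program [c] halts on the input [v] with output [y].
   In [mr_prec], the recursion variable and, in [mr_mu], the search variable
   come first; in [mr_prec] the recursive value comes second. *)
Fixpoint mr_eval n (c : murec n) : n.-tuple nat -> nat -> Prop :=
  match c with
  | mr_zero => fun _ y => y = 0%N
  | mr_succ => fun v y => y = (thead v).+1
  | mr_proj _ i => fun v y => y = tnth v i
  | mr_comp m _ f g => fun v y =>
      exists w : m.-tuple nat,
        (forall i, mr_eval (g i) v (tnth w i)) /\ mr_eval f w y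
  | mr_prec _ f g => fun v y =>
      exists s : nat -> nat,
        [/\ mr_eval f (behead_tuple v) (s 0%N),
            (forall i, (i < thead v)%N ->
               mr_eval g [tuple of i :: s i :: behead_tuple v] (s i.+1))
          & y = s (thead v)]
  | mr_mu _ f => fun v y =>
      mr_eval f [tuple of y :: v] 0%N /\
      (forall i, (i < y)%N ->
         exists z, mr_eval f [tuple of i :: v] z.+1)
  end.

(* No condition is imposed on the inputs which encode no instance. *)
Definition decidable_problem n (T : Type) (enc : T -> n.-tuple nat)
    (P : T -> Prop) : Prop :=
  exists c : murec n, forall t : T,
    (P t -> mr_eval c (enc t) 1%N) /\ (~ P t -> mr_eval c (enc t) 0%N).

(* Cantor's pairing function *)
Definition code_pair (a b : nat) : nat := ('C((a + b).+1, 2) + b)%N.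

Definition code_seq (s : seq nat) : nat :=
  foldr (fun a c => (code_pair a c).+1) 0%N s.

Definition code_int (z : int) : nat :=
  match z with Posz n => n.*2 | Negz n => n.*2.+1 end.

(* [idx r] is the bijection iota_{r+1} from Z x {1, ..., r+1} to N: the
   argument is shifted by one because the number of tracks is positive, and
   tracks are numbered from 0. *)
Record indexing := Indexing {
  idx : forall r : nat, int * 'I_r.+1 -> nat;
  idxV : forall r : nat, nat -> int * 'I_r.+1;
  idxK : forall r, cancel (@idx r) (@idxV r);
  idxVK : forall r, cancel (@idxV r) (@idx r);
  idx_computable : exists c : murec 3, forall r (i : int) (j : 'I_r.+1),
    mr_eval c [tuple r.+1; code_int i; nat_of_ord j] (idx (i, j));
  idxV_computable : exists c d : murec 2, forall r n : nat,
    mr_eval c [tuple r.+1; n] (code_int (idxV r n).1) /\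
    mr_eval d [tuple r.+1; n] (nat_of_ord (idxV r n).2)
}.

(* [Lpm r R P] is the finite presentation, with r+1 tracks and radius R, of a
   local polynomial map.  The variable Y_{u,h}, with -R <= u <= R and h < r+1,
   has number (u + R) * (r + 1) + h. *)
Record lpm := Lpm {
  lpm_r : nat;
  lpm_R : nat;
  lpm_P : 'I_lpm_r.+1 -> {mpoly int[lpm_R.*2.+1 * lpm_r.+1]}
}.
Arguments lpm_P : clear implicits.

Definition var_shift r R (k : 'I_(R.*2.+1 * r.+1)) : int :=
  (k %/ r.+1)%N%:Z - R%:Z.

Definition var_track r R (k : 'I_(R.*2.+1 * r.+1)) : 'I_r.+1 :=
  inord (k %% r.+1).

Definition lpm_map (I : indexing) (F : lpm) (x : nat -> int) : nat -> int :=
  fun n => let: (i, j) := idxV I (lpm_r F) n in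
    (lpm_P F j).@[fun k => x (idx I (i + var_shift k, var_track k))].

(* A finite set of maps is given by a list of presentations. *)
Definition lpm_orbit (I : indexing) (S : seq lpm) (x : nat -> int) :
    set (nat -> int) :=
  [set y | exists w : seq lpm, List.Forall (fun F => List.In F S) w /\
             y = foldl (fun z F => lpm_map I F z) x w]%classic.

Definition lpm_stable (I : indexing) (S : seq lpm) (x : nat -> int) : Prop :=
  finite_set (lpm_orbit I S x).

(* Monomials are listed in increasing order, so that a polynomial has exactly
   one code; the same holds for the coordinates in [code_fs_point]. *)
Definition code_mpoly n (p : {mpoly int[n]}) : nat :=
  code_seq
    [seq code_pair (code_int p@_m) (code_seq [seq m i | i <- enum 'I_n])
       | m : 'X_{1..n} <- sort <=%O (msupp p)].

Definition code_lpm (F : lpm) : nat :=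
  code_pair (lpm_r F).+1
    (code_pair (lpm_R F)
      (code_seq [seq code_mpoly (lpm_P F j) | j <- enum 'I_(lpm_r F).+1])).

Definition fs_point := {fsfun nat -> int with 0}.

Definition code_fs_point (x : fs_point) : nat :=
  code_seq [seq code_pair n (code_int (x n)) | n <- sort leq (finsupp x)].

(* Main.v *)
Require Import Defs.
From mathcomp Require Import all_boot all_algebra finmap.
From mathcomp Require Import mpoly zify.
From mathcomp Require Import boolp classical_sets cardinality.

(** A one-headed machine whose registers are markers on parallel tracks (the
    value of a register is the position of its marker) can run any mu-recursive
    program, and it is a local polynomial map of radius 1: encode the control
    state in one-hot form, one 0/1 track per instruction, so that every
    transition is a polynomial of degree at most 2 with integer coefficients.
    When the program is over, the head vanishes and the configuration is fixed;
    a head running off to infinity gives an infinite orbit.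

    Given a decider c for singletons, let M be the program which on input e
    runs c on e and on the code of the start point x_e of its own machine, halts
    if c answers "unstable" and runs off to infinity if c answers "stable".  If
    F is the map for M and e the code of F, then c is wrong on (F, x_e).  The
    point x_e has two nonzero cells, one at the origin and one at position e on
    track 1; its code depends on F only through the number of tracks, which can
    be read off e.  Only the runs of M on which c converges matter. *)

Set Implicit Arguments.
Unset Strict Implicit.
Unset Printing Implicit Defensive.

Import GRing.Theory.

(** * Total computable functions *)

Definition computable n (f : n.-tuple nat -> nat) : Prop :=
  exists c : murec n, forall v, mr_eval c v (f v).

(** Stated as stability under composition, so that it applies directly to compound expressions of
    any arity. *)
Definition computable1 (f : nat -> nat) : Prop :=
  forall n (a : n.-tuple nat -> nat), computable a -> computable (fun v => f (a v)).

Definition computable2 (f : nat -> nat -> nat) : Prop :=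
  forall n (a b : n.-tuple nat -> nat),
  computable a -> computable b -> computable (fun v => f (a v) (b v)).

Lemma computable_ext n (f g : n.-tuple nat -> nat) : f =1 g -> computable f -> computable g.
Proof. by move=> fg [c cP]; exists c => v; rewrite -fg. Qed.

Lemma computable_proj n (i : 'I_n) : computable (fun v => tnth v i).
Proof. by exists (mr_proj i). Qed.

Lemma computable_S : computable1 S.
Proof.
move=> n a [c cP]; exists (mr_comp mr_succ (fun=> c)) => v.
by exists [tuple a v]; split=> // i; rewrite (ord1 i).
Qed.

Lemma computable_const n k : computable (fun _ : n.-tuple nat => k).
Proof.
elim: k => [|k IHk]; last exact: computable_S.
exists (mr_comp mr_zero (fun i : 'I_0 => mr_proj (widen_ord (leq0n n) i))) => v.
by exists [tuple]; split=> // -[].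
Qed.

Lemma computable_prec f b h :
  (forall a, f 0 a = b a) -> (forall k a, f k.+1 a = h k (f k a) a) ->
  computable1 b ->
  computable (fun w : 3.-tuple nat => h (tnth w ord0) (tnth w 1%R) (tnth w ord_max)) ->
  computable2 f.
Proof.
move=> f0 fS b_comp [hc hP] n x y [xc xP] [yc yP].
have [bc bP] := b_comp 1 _ (computable_proj ord0).
exists (mr_comp (mr_prec bc hc) (tnth [tuple xc; yc])) => v.
exists [tuple x v; y v]; split.
  by case=> [[|[|]]] //= ?; rewrite !(tnth_nth 0) !(tnth_nth xc) /=.
exists (fun k => f k (y v)); split.
- by rewrite f0; have := bP [tuple y v]; congr mr_eval; apply: val_inj.
- move=> k _; rewrite fS; have := hP [tuple k; f k (y v); y v].
  by rewrite !(tnth_nth 0) /=; congr mr_eval; apply: val_inj.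
by rewrite /thead (tnth_nth 0).
Qed.

Lemma computable_id : computable1 id.
Proof. by []. Qed.

Lemma computable1_prec f k0 h : f 0 = k0 -> (forall k, f k.+1 = h k (f k)) ->
  computable2 h -> computable1 f.
Proof.
move=> f0 fS h_comp.
(* Primitive recursion is available with one parameter, so a dummy one is added and filled with the
   argument itself. *)
suff f_comp : computable2 (fun k _ => f k) by move=> n a ca; apply: (f_comp _ a a).
apply: (@computable_prec _ (fun=> k0) (fun k y _ => h k y)) => // [? ? _|].
  exact: computable_const.
by apply: h_comp; apply: computable_proj.
Qed.

Lemma computable_add : computable2 addn.
Proof.
apply: (@computable_prec _ id (fun _ y _ => y.+1)) => //.
by apply: computable_S; apply: computable_proj.
Qed.

Lemma computable_pred : computable1 predn.
Proof. exact: (@computable1_prec _ 0 (fun k _ => k)). Qed.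

Lemma computable_sub : computable2 subn.
Proof.
move=> n a b a_comp b_comp.
apply: (@computable_prec (fun k a => a - k) id (fun _ y _ => y.-1)) b_comp a_comp.
- exact: subn0.
- by move=> k a'; rewrite subnS.
- exact: computable_id.
by apply: computable_pred; apply: computable_proj.
Qed.

Lemma computable_minn : computable2 minn.
Proof.
move=> n a b ca cb.
apply: (@computable_ext _ (fun v => a v - (a v - b v))) => [v|]; first by rewrite -minnE.
by do ?[apply: computable_sub].
Qed.

Lemma computable_maxn : computable2 maxn.
Proof.
move=> n a b ca cb.
apply: (@computable_ext _ (fun v => a v + (b v - a v))) => [v|]; first by rewrite -maxnE.
by apply: computable_add => //; apply: computable_sub.
Qed.

Lemma computable_double : computable1 double.
Proof.
move=> n a ca.
apply: (@computable_ext _ (fun v => a v + a v)) => [v|]; first by rewrite addnn.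
exact: computable_add.
Qed.

(** * Inverting Cantor's pairing function *)

Definition tri (s : nat) : nat := 'C(s.+1, 2).

Lemma triS s : tri s.+1 = tri s + s.+1.
Proof. by rewrite /tri binS bin1. Qed.

Lemma leq_tri s t : s <= t -> tri s <= tri t.
Proof. by move=> st; apply: leq_bin2l. Qed.

Lemma computable_tri : computable1 tri.
Proof.
apply: (@computable1_prec _ 0 (fun k y => y + k.+1)) => // [|n a b ca cb]; first exact: triS.
by apply: computable_add => //; apply: computable_S.
Qed.

Lemma computable_pair : computable2 code_pair.
Proof.
move=> n a b ca cb; apply: computable_add => //; apply: computable_tri.
exact: computable_add.
Qed.

(* The largest s with [tri s <= e]: the diagonal on which [e] lies. *)
Fixpoint diagonal (e : nat) : nat :=
  if e is k.+1 then diagonal k + (1 - (tri (diagonal k).+1 - k.+1)) else 0.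

(** Since [code_pair a b] is [tri (a + b) + b], the offset of [e] on its diagonal is [b], and [a] is
    what remains of the diagonal's number. *)
Definition unpair1 (e : nat) : nat := diagonal e - (e - tri (diagonal e)).

Lemma diagonalP e : tri (diagonal e) <= e < tri (diagonal e).+1.
Proof.
elim: e => [|e] //=; set s := diagonal e; rewrite !triS.
(* Truncated subtraction acts as a test: the increment in [diagonal] is 1 if the next triangular
   number has been reached and 0 otherwise. *)
by have [?|?] := leqP (tri s + s.+1) e.+1; case/andP=> *;
  [have -> : s + (1 - (tri s + s.+1 - e.+1)) = s.+1 by lia |
   have -> : s + (1 - (tri s + s.+1 - e.+1)) = s by lia]; rewrite ?triS; lia.
Qed.

Lemma unpair1K a b : unpair1 (code_pair a b) = a.
Proof.
rewrite /unpair1 /code_pair -/(tri _); set e := tri _ + b.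
have /andP[le_e lt_e] := diagonalP e.
have -> : diagonal e = a + b.
  apply/eqP; rewrite eqn_leq; apply/andP; split; rewrite leqNgt; apply/negP => /leq_tri lt.
    by move: (leq_trans lt le_e); rewrite triS /e; lia.
  by have := leq_trans lt_e lt; rewrite /e; lia.
by rewrite /e; lia.
Qed.

Lemma computable_unpair1 : computable1 unpair1.
Proof.
have cd : computable1 diagonal.
  apply: (@computable1_prec _ 0 (fun k y => y + (1 - (tri y.+1 - k.+1)))) => // n a b ca cb.
  apply: computable_add => //; apply: computable_sub; first exact: computable_const.
  apply: computable_sub; last exact: computable_S.
  by apply: computable_tri; apply: computable_S.
move=> n a ca; apply: computable_sub; first exact: cd.
by apply: computable_sub => //; apply: computable_tri; apply: cd.
Qed.

(** * Head programs for mu-recursive functions *)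

(** Everything is local: the head moves by one cell, possibly dragging one marker, and a loop stops
    when the head stands on a given marker. *)
Inductive prog : Type :=
| Skip
| Mv (right : bool) (carried : option nat)
| Seq (p q : prog)
| Until (r : nat) (p : prog).

Definition upd (s : nat -> nat) (r v : nat) : nat -> nat :=
  fun i => if i == r then v else s i.

Definition carry (c : option nat) (s : nat -> nat) (p : nat) : nat -> nat :=
  if c is Some r then upd s r p else s.

(** A marker can only be dragged from the cell of the head; this is what makes the update of markers
    by adding and subtracting head indicators correct. *)
Definition can_carry (c : option nat) (s : nat -> nat) (p : nat) : Prop :=
  if c is Some r then s r = p else True.

Inductive exec : prog -> (nat -> nat) * nat -> (nat -> nat) * nat -> Prop :=
| exec_skip s : exec Skip s s
| exec_right c s p : can_carry c s p ->
    exec (Mv true c) (s, p) (carry c s p.+1, p.+1)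
| exec_left c s p : can_carry c s p.+1 ->
    exec (Mv false c) (s, p.+1) (carry c s p, p)
| exec_seq a b s1 s2 s3 : exec a s1 s2 -> exec b s2 s3 -> exec (Seq a b) s1 s3
| exec_done r a s : s.1 r = s.2 -> exec (Until r a) s s
| exec_loop r a s1 s2 s3 : s1.1 r <> s1.2 ->
    exec a s1 s2 -> exec (Until r a) s2 s3 -> exec (Until r a) s1 s3.

Definition run (a : prog) (s t : nat -> nat) : Prop := exec a (s, 0) (t, 0).

Definition goto (r : nat) := Until r (Mv true None).
(** Register 1 is the home marker: it stays at 0, so that the head can recognise the origin. *)
Definition gohome := Until 1 (Mv false None).
Definition inc (r : nat) := Seq (goto r) (Seq (Mv true (Some r)) gohome).
Definition reset (r : nat) := Seq (goto r) (Until 1 (Mv false (Some r))).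
Definition copy (a b : nat) :=
  Seq (reset b) (Seq (Until a (Mv true (Some b))) gohome).

Lemma upd_same s r v : upd s r v r = v.
Proof. by rewrite /upd eqxx. Qed.

Lemma upd_other s r v i : i <> r -> upd s r v i = s i.
Proof. by rewrite /upd; case: eqP. Qed.

Lemma upd_upd s r v w : upd (upd s r v) r w = upd s r w.
Proof. by apply/funext => i; rewrite /upd; case: eqP. Qed.

Lemma upd_id s r : upd s r (s r) = s.
Proof. by apply/funext => i; rewrite /upd; case: eqP => [->|]. Qed.

Lemma exec_goto r s p : p <= s r -> exec (goto r) (s, p) (s, s r).
Proof.
elim: {p}(s r - p) {-2}p (erefl (s r - p)) => [|k IHk] p def_k le_p.
  have ->: p = s r by lia.
  by apply: exec_done.
apply: exec_loop (IHk p.+1 _ _); try lia; [by move=> /=; lia | exact: (@exec_right None)].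
Qed.

Lemma exec_gohome s p : s 1 = 0 -> exec gohome (s, p) (s, 0).
Proof.
move=> s1; elim: p => [|p IHp]; first exact: exec_done.
by apply: exec_loop IHp => /=; [rewrite s1 | exact: (@exec_left None)].
Qed.

Lemma run_inc r s : r <> 1 -> s 1 = 0 -> run (inc r) s (upd s r (s r).+1).
Proof.
move=> r1 s1; apply: exec_seq (exec_goto _) _ => //.
apply: exec_seq; first exact: (@exec_right (Some r)).
by apply: exec_gohome; rewrite /= upd_other // => /esym.
Qed.

Lemma run_reset r s : r <> 1 -> s 1 = 0 -> run (reset r) s (upd s r 0).
Proof.
move=> r1 s1; apply: exec_seq (exec_goto _) _ => //.
(* The position of the marker is made explicit, so that it decreases together with that of the
   head. *)
rewrite -{1}(upd_id s r); elim: (s r) => [|p IHp].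
  by apply: exec_done; rewrite /= upd_other // => /esym.
apply: exec_loop IHp; first by rewrite /= upd_other ?s1 // => /esym.
by rewrite -(upd_upd s r p.+1 p); apply: (@exec_left (Some r)); rewrite /= upd_same.
Qed.

Lemma run_copy a b s : a <> b -> b <> 1 -> s 1 = 0 ->
  run (copy a b) s (upd s b (s a)).
Proof.
move=> ab b1 s1; apply: exec_seq (run_reset _ _) _ => //.
apply: (@exec_seq _ _ _ (upd s b (s a), s a)); last first.
  by apply: exec_gohome; rewrite upd_other // => /esym.
have loop p : p <= s a ->
    exec (Until a (Mv true (Some b))) (upd s b p, p) (upd s b (s a), s a).
  elim: {p}(s a - p) {-2}p (erefl (s a - p)) => [|k IHk] p def_k le_p.
    have -> : p = s a by lia.
    by apply: exec_done; rewrite /= upd_other.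
  apply: exec_loop (IHk p.+1 _ _); try lia; first by rewrite /= upd_other //; lia.
  rewrite -(upd_upd s b p p.+1).
  by apply: (@exec_right (Some b)); rewrite /= upd_same.
exact: loop.
Qed.

(** * Compilation of mu-recursive functions *)

Definition seqs n (F : 'I_n -> prog) : prog := foldr Seq Skip [seq F i | i <- enum 'I_n].

Definition cons_fun n (a : nat) (f : 'I_n -> nat) (i : 'I_n.+1) : nat :=
  oapp f a (unlift ord0 i).

(* The program for [c] reads its arguments in the registers [ins], writes its
   result to [out], and uses the registers from [fr] on as scratch space. *)
Fixpoint compile n (c : murec n) : ('I_n -> nat) -> nat -> nat -> prog :=
  match c in murec n return ('I_n -> nat) -> nat -> nat -> prog with
  | mr_zero => fun _ out _ => reset out
  | mr_succ => fun ins out _ => Seq (copy (ins ord0) out) (inc out)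
  | mr_proj _ i => fun ins out _ => copy (ins i) out
  | mr_comp m _ f g => fun ins out fr =>
      Seq (seqs (fun i : 'I_m => compile (g i) ins (fr + i) (fr + m)))
          (compile f (fun i => fr + i) out (fr + m))
  | mr_prec _ f g => fun ins out fr =>
      Seq (compile f (fun i => ins (lift ord0 i)) fr.+1 fr.+3)
     (Seq (reset fr)
     (Seq (goto fr)
     (Seq (Until (ins ord0)
            (Seq gohome
            (Seq (compile g (cons_fun fr (cons_fun fr.+1
                               (fun i => ins (lift ord0 i)))) fr.+2 fr.+3)
            (Seq (copy fr.+2 fr.+1)
            (Seq (inc fr) (goto fr))))))
     (Seq gohome (copy fr.+1 out)))))
  | mr_mu _ f => fun ins out fr =>
      Seq (reset fr)
     (Seq (compile f (cons_fun fr ins) fr.+1 fr.+2)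
     (Seq (Until fr.+1
            (Seq (inc fr) (compile f (cons_fun fr ins) fr.+1 fr.+2)))
          (copy fr out)))
  end.

Definition agree (fr out : nat) (s t : nat -> nat) : Prop :=
  forall r, r < fr -> r <> out -> t r = s r.

(** Only convergent evaluations are simulated. Scratch registers may hold anything at the start; the
    inputs and the home marker survive, being below [fr] and different from [out]. *)
Definition compile_spec n (c : murec n) : Prop :=
  forall ins out fr s (v : n.-tuple nat) y, mr_eval c v y ->
    1 < fr -> out < fr -> out <> 1 -> s 1 = 0 ->
    (forall i, ins i < fr) -> (forall i, ins i <> out) ->
    (forall i, s (ins i) = tnth v i) ->
  exists t, [/\ run (compile c ins out fr) s t, t out = y & agree fr out s t].

Lemma compile_comp m n (f : murec m) (g : 'I_m -> murec n) :
  compile_spec f -> (forall i, compile_spec (g i)) ->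
  compile_spec (mr_comp f g).
Proof.
move=> fP gP ins out fr s v y [w [gw fw]] fr1 lt_out out1 s1 lt_ins ins_out sv.
(* Induction over the components still to be run. The last clause protects the results already
   stored from the later components. *)
have step (l : seq 'I_m) : uniq l -> forall s0 : nat -> nat, s0 1 = 0 ->
    (forall i, s0 (ins i) = tnth v i) ->
  exists t, [/\ run (foldr Seq Skip [seq compile (g i) ins (fr + i) (fr + m) | i <- l]) s0 t,
    (forall i, i \in l -> t (fr + i) = tnth w i),
    (forall r, r < fr -> t r = s0 r) &
    (forall i, i \notin l -> t (fr + i) = s0 (fr + i))].
  elim: l => [|i l IHl] /= Ul s0 s01 s0v.
    by exists s0; split=> //; apply: exec_skip.
  have /andP[il ul] := Ul.
  have [|||||||t [t_run t_i t_ag]] := gP i ins (fr + i) (fr + m) s0 v _ (gw i); 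
    try lia; try by [].
  - by have := ltn_ord i; lia.
  - by move=> j; have := lt_ins j; lia.
  - by move=> j; have := lt_ins j; lia.
  have low r : r < fr -> t r = s0 r by move=> r_fr; apply: t_ag; lia.
  have [||u [u_run u_l u_low u_nl]] := IHl ul t.
  - by rewrite low.
  - by move=> j; rewrite low.
  exists u; split.
  - exact: exec_seq t_run u_run.
  - by move=> j; rewrite inE; case: (eqVneq j i) => [-> _|_ /u_l //]; rewrite u_nl.
  - by move=> r r_fr; rewrite u_low ?low.
  move=> j; rewrite inE negb_or => /andP[/eqP ji jl]; rewrite u_nl //.
  apply: t_ag; first by have := ltn_ord j; lia.
  by move=> e; apply: ji; apply: val_inj => /=; lia.
have [t [t_run t_w t_low _]] := step _ (enum_uniq 'I_m) s s1 sv.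
have [|||||||u [u_run u_out u_ag]] := fP (fun i => fr + i) out (fr + m) t w y fw;
  try lia.
- by rewrite t_low.
- by move=> i; have := ltn_ord i; lia.
- by move=> i; apply: t_w; rewrite mem_enum.
exists u; split=> //; first exact: exec_seq t_run u_run.
by move=> r r_fr r_out; rewrite u_ag ?t_low //; lia.
Qed.

Lemma cons_fun0 n a (f : 'I_n -> nat) : cons_fun a f ord0 = a.
Proof. by rewrite /cons_fun unlift_none. Qed.

Lemma cons_funS n a (f : 'I_n -> nat) i : cons_fun a f (lift ord0 i) = f i.
Proof. by rewrite /cons_fun liftK. Qed.

Lemma cons_fun_lt n a (f : 'I_n -> nat) k :
  a < k -> (forall i, f i < k) -> forall i, cons_fun a f i < k.
Proof. by move=> ak fk i; rewrite /cons_fun; case: (unlift ord0 i). Qed.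

Lemma cons_fun_tuple n a (f : 'I_n -> nat) (s : nat -> nat) x (v : n.-tuple nat) :
  s a = x -> (forall i, s (f i) = tnth v i) ->
  forall i, s (cons_fun a f i) = tnth [tuple of x :: v] i.
Proof.
move=> sa sf i; case: (unliftP ord0 i) => [j ->|->].
  by rewrite cons_funS tnthS.
by rewrite cons_fun0 tnth0.
Qed.

(** Register [fr] is the counter, [fr.+1] the accumulator and [fr.+2] the new value. The head is
    parked on the counter before each test, so meeting the marker of the recursion argument means
    that the counter has reached it. *)
Lemma compile_prec n (f : murec n) (g : murec n.+2) :
  compile_spec f -> compile_spec g -> compile_spec (mr_prec f g).
Proof.
move=> fP gP ins out fr s v y [h [h0 hS ->]] fr1 lt_out out1 s1 lt_ins ins_out sv.
set w := behead_tuple v in h0 hS *; set k := thead v in hS *.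
pose inp i := ins (lift ord0 i).
have sw i : s (inp i) = tnth w i.
  rewrite sv tnth_behead; congr tnth; apply: val_inj.
  by rewrite /= inordK ?ltnS ?ltn_ord.
have lt_inp i : inp i < fr by apply: lt_ins.
have sk : s (ins ord0) = k by rewrite sv.
have lt_k := lt_ins ord0.
have [|||||||t [t_run t_acc t_ag]] := fP inp fr.+1 fr.+3 s w _ h0; try lia; try by [].
- by move=> i; have := lt_inp i; lia.
- by move=> i; have := lt_inp i; lia.
have loop j u : j <= k -> u fr.+1 = h j -> u fr = j -> (forall r, r < fr -> u r = s r) ->
  exists u', [/\ exec (Until (ins ord0)
            (Seq gohome
            (Seq (compile g (cons_fun fr (cons_fun fr.+1 inp)) fr.+2 fr.+3)
            (Seq (copy fr.+2 fr.+1)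
            (Seq (inc fr) (goto fr)))))) (u, j) (u', k),
     u' fr.+1 = h k & (forall r, r < fr -> u' r = s r)].
  elim: {j}(k - j) {-2}j u (erefl (k - j)) => [|d IHd] j u def_d le_jk u_acc u_j u_low.
    have jk: j = k by lia.
    by exists u; split=> //; [rewrite jk; apply: exec_done; rewrite /= u_low | rewrite -jk].
  have lt_regs i : cons_fun fr (cons_fun fr.+1 inp) i < fr.+2.
    apply: cons_fun_lt => [|{}i]; first by lia.
    by apply: cons_fun_lt => [|{}i]; [lia | have := lt_inp i; lia].
  have lt_jk : j < k by lia.
  have u1 : u 1 = 0 by rewrite u_low.
  have [|||||||t1 [t1_run t1_tmp t1_ag]] := gP (cons_fun fr (cons_fun fr.+1 inp))
       fr.+2 fr.+3 u _ _ (hS j lt_jk); try lia.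
  - by move=> i; have := lt_regs i; lia.
  - by move=> i; have := lt_regs i; lia.
  - apply: cons_fun_tuple => //; apply: cons_fun_tuple => // i.
    by rewrite u_low.
  pose t2 := upd t1 fr.+1 (t1 fr.+2).
  pose t3 := upd t2 fr (t2 fr).+1.
  have t1low r : r < fr -> t1 r = s r by move=> r_fr; rewrite t1_ag ?u_low //; lia.
  have t2low r : r < fr -> t2 r = s r by move=> r_fr; rewrite /t2 upd_other ?t1low //; lia.
  have t3low r : r < fr -> t3 r = s r.
    by move=> r_fr; rewrite /t3 upd_other ?t2low // => ?; lia.
  have t3fr : t3 fr = j.+1.
    by rewrite /t3 upd_same /t2 upd_other ?t1_ag ?u_j //; lia.
  have [|||||u' [u'_run u'_acc u'_low]] := IHd j.+1 t3; try lia; try by [].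
    by rewrite /t3 upd_other ?/t2 ?upd_same //; lia.
  exists u'; split=> //; apply: exec_loop u'_run.
    by rewrite /= u_low // sk; lia.
  apply: exec_seq (exec_gohome _ u1) _.
  apply: exec_seq t1_run _.
  have copy_run : run (copy fr.+2 fr.+1) t1 t2 by apply: run_copy; rewrite ?t1low; lia.
  have inc_run : run (inc fr) t2 t3 by apply: run_inc; rewrite ?t2low; lia.
  apply: exec_seq copy_run _; apply: exec_seq inc_run _.
  by rewrite -t3fr; apply: exec_goto.
have t1 : t 1 = 0 by rewrite t_ag //; lia.
have [|||u' [u'_run u'_acc u'_low]] := loop 0 (upd t fr 0) (leq0n _).
- by rewrite upd_other //; lia.
- by rewrite upd_same.
- by move=> r r_fr; rewrite upd_other ?t_ag //; lia.
have u'1 : u' 1 = 0 by rewrite u'_low.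
exists (upd u' out (u' fr.+1)); split.
- apply: exec_seq t_run _; apply: exec_seq; first by apply: run_reset; lia.
  apply: exec_seq; first exact: exec_goto.
  rewrite upd_same; apply: exec_seq u'_run _.
  apply: exec_seq; first exact: exec_gohome.
  by apply: run_copy; lia.
- by rewrite upd_same.
by move=> r r_fr r_out; rewrite upd_other ?u'_low.
Qed.

(** Register [fr] holds the candidate and [fr.+1] the value of [f] there. The head is at the origin
    at each test, so the loop stops when this value is 0. *)
Lemma compile_mu n (f : murec n.+1) : compile_spec f -> compile_spec (mr_mu f).
Proof.
move=> fP ins out fr s v y [fy f_lt] fr1 lt_out out1 s1 lt_ins ins_out sv.
set body := compile f (cons_fun fr ins) fr.+1 fr.+2.
have lt_regs i : cons_fun fr ins i < fr.+1.
  by apply: cons_fun_lt => [|{}i]; [lia | have := lt_ins i; lia].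
have eval_f j z u : u fr = j -> (forall r, r < fr -> u r = s r) ->
    mr_eval f [tuple of j :: v] z ->
  exists t, [/\ run body u t, t fr.+1 = z, t fr = j & (forall r, r < fr -> t r = s r)].
  move=> u_j u_low fz.
  have [|||||||t [t_run t_z t_ag]] := fP (cons_fun fr ins) fr.+1 fr.+2 u _ _ fz; try lia.
  - by rewrite u_low.
  - by move=> i; have := lt_regs i; lia.
  - by move=> i; have := lt_regs i; lia.
  - by apply: cons_fun_tuple => // i; rewrite u_low.
  exists t; split=> //; first by rewrite t_ag //; lia.
  by move=> r r_fr; rewrite t_ag ?u_low //; lia.
have loop j u : j <= y -> u fr = j -> (forall r, r < fr -> u r = s r) ->
  exists u', [/\ run (Seq body (Until fr.+1 (Seq (inc fr) body))) u u', u' fr = y &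
                 (forall r, r < fr -> u' r = s r)].
  elim: {j}(y - j) {-2}j u (erefl (y - j)) => [|d IHd] j u def_d le_jy u_j u_low.
    have jy : j = y by lia.
    have [|t [t_run t_z t_j t_low]] := eval_f y 0 u _ u_low fy; first by rewrite u_j.
    exists t; split=> //; apply: exec_seq t_run _.
    by apply: exec_done; rewrite /= t_z.
  have [z fz] : exists z, mr_eval f [tuple of j :: v] z.+1 by apply: f_lt; lia.
  have [t [t_run t_z t_j t_low]] := eval_f _ _ u u_j u_low fz.
  have [||||u' [u'_run u'_y u'_low]] := IHd j.+1 (upd t fr j.+1); try lia.
  - by rewrite upd_same.
  - by move=> r r_fr; rewrite upd_other ?t_low //; lia.
  exists u'; split=> //; apply: exec_seq t_run _.
  (* The run for [j.+1] is cut after its first evaluation, which becomes, with the increment before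
     it, one turn of the loop. *)
  move: u'_run; rewrite /run => H; inversion H; subst.
  apply: exec_loop H5; first by rewrite /= t_z.
  apply: exec_seq H2.
  by rewrite -t_j; apply: run_inc; rewrite ?t_low //; lia.
have [||u [u_run u_y u_low]] := loop 0 (upd s fr 0) (leq0n _).
- by rewrite upd_same.
- by move=> r r_fr; rewrite upd_other //; lia.
exists (upd u out (u fr)); split.
- apply: exec_seq; first by apply: run_reset; lia.
  move: u_run; rewrite /run => H; inversion H; subst.
  apply: exec_seq H2 _; apply: exec_seq H5 _.
  by apply: run_copy; rewrite ?u_low //; lia.
- by rewrite upd_same.
by move=> r r_fr r_out; rewrite upd_other ?u_low.
Qed.

Lemma compileP n (c : murec n) : compile_spec c.
Proof.
elim: c => {n} [||n i|m n f IHf g IHg|n f IHf g IHg|n f IHf].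
- move=> ins out fr s v y /= -> fr1 lt_out out1 s1 _ _ _.
  exists (upd s out 0); split; [exact: run_reset | exact: upd_same |].
  by move=> r _ ?; rewrite upd_other.
- move=> ins out fr s v y /= -> fr1 lt_out out1 s1 _ ins_out sv.
  pose t := upd s out (s (ins ord0)).
  exists (upd t out (t out).+1); split.
  + apply: exec_seq (run_copy _ _ _) (run_inc _ _) => //.
    by rewrite upd_other // => /esym.
  + by rewrite upd_same /t upd_same sv.
  by move=> r _ ?; rewrite upd_other // /t upd_other.
- move=> ins out fr s v y /= -> fr1 lt_out out1 s1 _ ins_out sv.
  exists (upd s out (s (ins i))); split; first exact: run_copy.
    by rewrite upd_same.
  by move=> r _ ?; rewrite upd_other.
- exact: compile_comp.
- exact: compile_prec.
exact: compile_mu.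
Qed.

(** * Flat code *)

Inductive instr : Type :=
| IMv (right : bool) (carried : option nat)
| ITest (r yes no : nat).

Definition noop := ITest 0 0 0.

Inductive step (code : seq instr) :
    nat * ((nat -> nat) * nat) -> nat * ((nat -> nat) * nat) -> Prop :=
| step_right q c s p : q < size code -> nth noop code q = IMv true c ->
    can_carry c s p -> step code (q, (s, p)) (q.+1, (carry c s p.+1, p.+1))
| step_left q c s p : q < size code -> nth noop code q = IMv false c ->
    can_carry c s p.+1 -> step code (q, (s, p.+1)) (q.+1, (carry c s p, p))
| step_test q r a b s p : q < size code -> nth noop code q = ITest r a b ->
    step code (q, (s, p)) (if s r == p then a else b, (s, p)).

Inductive steps (code : seq instr) c : nat * ((nat -> nat) * nat) -> Prop :=
| steps_refl : steps code c c
| steps_snoc d e : steps code c d -> step code d e -> steps code c e.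

Lemma steps_trans code c d e : steps code c d -> steps code d e -> steps code c e.
Proof. by move=> cd; elim=> // e1 e2 _ ? ?; apply: steps_snoc; eassumption. Qed.

Lemma step_steps code c d : step code c d -> steps code c d.
Proof. by apply: steps_snoc; apply: steps_refl. Qed.

(** Here [k] is the address of the first instruction. A loop is an exit test, the body, and a jump
    back in the form of a test with equal targets. *)
Fixpoint flatten_prog (a : prog) (k : nat) : seq instr :=
  match a with
  | Skip => [::]
  | Mv d c => [:: IMv d c]
  | Seq a b =>
      flatten_prog a k ++ flatten_prog b (k + size (flatten_prog a k))
  | Until r a =>
      let body := flatten_prog a k.+1 in
      ITest r (k + size body).+2 k.+1 :: body ++ [:: ITest r k k]
  end.

Lemma nth_cat_size (pre : seq instr) i post : nth noop (pre ++ i :: post) (size pre) = i.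
Proof. by rewrite nth_cat ltnn subnn. Qed.

(** The surrounding code is arbitrary, since the induction runs subprograms in place inside larger
    ones. *)
Lemma exec_steps a c d : exec a c d -> forall pre post k, k = size pre ->
  steps (pre ++ flatten_prog a k ++ post) (k, c) (k + size (flatten_prog a k), d).
Proof.
elim=> {a c d} [s|c s p cP|c s p cP|a b s1 s2 s3 _ IHa _ IHb|r a [s p] /= sr|
    r a [s p] s2 s3 /= sr _ IHa _ IHu] pre post k ->.
- by rewrite addn0; apply: steps_refl.
- rewrite addn1; apply/step_steps/step_right; rewrite ?nth_cat_size //.
  by rewrite !size_cat /=; lia.
- rewrite addn1; apply/step_steps/step_left; rewrite ?nth_cat_size //.
  by rewrite !size_cat /=; lia.
- rewrite /= -catA size_cat addnA.
  set A := flatten_prog a _; set B := flatten_prog b _.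
  apply: steps_trans (IHa pre (B ++ post) _ erefl) _.
  by have := IHb (pre ++ A) post _ (erefl _); rewrite size_cat -catA.
- rewrite /=; set body := flatten_prog a _.
  rewrite size_cat addn1 !addnS; set code := pre ++ _.
  have lt_code : size pre < size code by rewrite size_cat /=; lia.
  have := step_test s p lt_code (nth_cat_size _ _ _).
  by rewrite sr eqxx => /step_steps.
have {IHu} := IHu pre post _ erefl; rewrite /=; set body := flatten_prog a _ => IHu.
apply: steps_trans IHu.
set code := pre ++ _.
have code_eq : code = (rcons pre (ITest r (size pre + size body).+2 (size pre).+1))
    ++ body ++ (ITest r (size pre) (size pre) :: post).
  by rewrite /code cat_rcons /= -catA.
apply: (@steps_trans _ _ ((size pre).+1, (s, p))).
  have lt_code : size pre < size code by rewrite size_cat /=; lia.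
  have := step_test s p lt_code (nth_cat_size _ _ _).
  by case: eqP sr => // _ _ /step_steps.
have {IHa} := IHa (rcons pre (ITest r (size pre + size body).+2 (size pre).+1))
  (ITest r (size pre) (size pre) :: post) _ (esym (size_rcons _ _)).
rewrite -/body -code_eq => IHa; apply: steps_trans IHa _.
case: s2 {sr} => s2 p2.
have lt_code : (size pre).+1 + size body < size code.
  by rewrite code_eq !size_cat size_rcons /=; lia.
have nth_code : nth noop code ((size pre).+1 + size body) = ITest r (size pre) (size pre).
  rewrite code_eq catA; set l := rcons pre _ ++ body.
  have -> : (size pre).+1 + size body = size l by rewrite /l size_cat size_rcons.
  by rewrite nth_cat_size.
by have := step_test s2 p2 lt_code nth_code; rewrite if_same => /step_steps.
Qed.

Lemma flatten_steps a c d : exec a c d ->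
  steps (flatten_prog a 0) (0, c) (size (flatten_prog a 0), d).
Proof. by move=> /exec_steps/(_ [::] [::] 0 erefl); rewrite cats0. Qed.

Fixpoint prog_bounded (K : nat) (a : prog) : bool :=
  match a with
  | Skip => true
  | Mv _ c => if c is Some r then r < K else true
  | Seq a b => prog_bounded K a && prog_bounded K b
  | Until r a => (r < K) && prog_bounded K a
  end.

Definition instr_bounded (K : nat) (i : instr) : bool :=
  match i with
  | IMv _ c => if c is Some r then r < K else true
  | ITest r _ _ => r < K
  end.

Lemma flatten_bounded K a k :
  prog_bounded K a -> all (instr_bounded K) (flatten_prog a k).
Proof.
elim: a k => [|d c|a IHa b IHb|r a IHa] k //=; first by rewrite andbT.
  by case/andP=> aK bK; rewrite all_cat IHa ?IHb.
by case/andP=> rK aK; rewrite all_cat /= rK IHa.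
Qed.

Lemma prog_bounded_leq K L a : K <= L -> prog_bounded K a -> prog_bounded L a.
Proof.
move=> KL; elim: a => [|d [r|]|a IHa b IHb|r a IHa] //=; lia.
Qed.

Lemma ex_prog_bounded a : exists K, prog_bounded K a.
Proof.
elim: a => [|d [r|]|a [K aK] b [L bL]|r a [K aK]]; try by exists 0.
- by exists r.+1 => /=.
- exists (maxn K L) => /=; apply/andP; split.
    by apply: prog_bounded_leq aK; lia.
  by apply: prog_bounded_leq bL; lia.
exists (maxn K r.+1) => /=; apply/andP; split; first by lia.
by apply: prog_bounded_leq aK; lia.
Qed.

(** * The local polynomial map of a machine *)

Local Open Scope ring_scope.

Section Rule.
Variables (A : pzRingType) (K : nat) (code : seq instr) (v : nat -> nat -> A).

Definition head_track (q : nat) : nat := (K + q).+1.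

(** The marker appears in the cell that the head enters and is deleted in the one that it leaves; a
    head moving right enters from the left neighbour. *)
Definition carried_in (r q : nat) : A :=
  if nth noop code q is IMv d (Some r') then
    if r' == r then v (if d then 0%N else 2%N) (head_track q) - v 1%N (head_track q) else 0
  else 0.

(** A test multiplies the head indicator by the marker indicator or its complement; this is the only
    source of degree 2. *)
Definition jump (q q' : nat) : A :=
  match nth noop code q with
  | IMv d _ => if q' == q.+1 then v (if d then 0%N else 2%N) (head_track q) else 0
  | ITest r a b => v 1%N (head_track q) *
      ((if q' == a then v 1%N r.+1 else 0) + (if q' == b then 1 - v 1%N r.+1 else 0))
  end.

(* Track 0 is the start signal, track r+1 carries the marker of the register r
   (at the position equal to its value) and track [head_track q] marks the position
   of the machine when it is about to execute the instruction q.  The first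
   argument 0, 1, 2 of [v] stands for the left neighbour, the cell itself and
   the right neighbour. *)
Definition rule (j : nat) : A :=
  if j is j'.+1 then
    if (j' < K)%N then
      v 1%N j + (if j' == 0%N then 0 else v 1%N 0%N) + \sum_(q < size code) carried_in j' q
    else (if j' == K then v 1%N 0%N else 0) + \sum_(q < size code) jump q (j' - K)
  else 0.

End Rule.

(** One formula serves both for the polynomials and for their values; evaluation is a ring morphism
    between the two readings. *)
Lemma rmorph_rule (A B : pzRingType) (f : {rmorphism A -> B}) K code v j :
  f (rule K code v j) = rule K code (fun u h => f (v u h)) j.
Proof.
case: j => [|j] /=; first by rewrite rmorph0.
case: ifP => _; rewrite !rmorphD rmorph_sum /=.
  congr (_ + _ + _); first by case: ifP; rewrite ?rmorph0.
  apply: eq_bigr => q _; rewrite /carried_in.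
  by case: nth => [d [r|]|r a b]; try case: ifP; rewrite ?rmorphB ?rmorph0.
congr (_ + _); first by case: ifP; rewrite ?rmorph0.
apply: eq_bigr => q _; rewrite /jump.
case: nth => [d c|r a b]; first by case: ifP; rewrite ?rmorph0.
by rewrite rmorphM rmorphD; do 2?case: ifP; rewrite ?rmorphB ?rmorph1 ?rmorph0.
Qed.

(** Here [u] is the shift plus the radius 1; the value 0 is a default for numbers out of range. *)
Definition var (r u h : nat) : {mpoly int[1.*2.+1 * r.+1]} :=
  if insub (u * r.+1 + h)%N is Some k then 'X_k else 0.

Definition machine (K : nat) (code : seq instr) : lpm :=
  @Lpm (K + size code) 1 (fun j => rule K code (var (K + size code)) j).

Section Simulation.
Variables (I : indexing) (K : nat) (code : seq instr).

Let r := (K + size code)%N.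
Let F := machine K code.

Definition cell (x : nat -> int) (i : int) (h : nat) : int :=
  x (idx I (i, inord h : 'I_r.+1)).

Definition nbhd (x : nat -> int) (i : int) (k : 'I_(1.*2.+1 * r.+1)) : int :=
  x (idx I (i + var_shift k, var_track k)).

Lemma meval_var x i u h : (u < 3)%N -> (h < r.+1)%N ->
  (var r u h).@[nbhd x i] =
  cell x (i + u%:Z - 1) h.
Proof.
move=> u3 hr; rewrite /var; have lt_k : (u * r.+1 + h < 1.*2.+1 * r.+1)%N.
  move: u3; case: u => [|[|[|]]] //=; lia.
rewrite insubT mevalXU /cell /nbhd /var_shift /var_track /=.
by rewrite modnMDl modn_small // divnMDl // divn_small // addn0 addrA.
Qed.

Lemma cell_machine x i j : (j < r.+1)%N ->
  cell (lpm_map I F x) i j =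
  rule K code (fun u h => (var r u h).@[nbhd x i]) j.
Proof.
move=> jr; rewrite /cell /lpm_map idxK /= inordK //.
exact: (rmorph_rule (meval _)).
Qed.

(** A program counter outside the code is represented by the absence of a head. *)
Definition represents (x : nat -> int) (c : nat * ((nat -> nat) * nat)) : Prop :=
  forall i, [/\ cell x i 0 = 0,
    forall r', (r' < K)%N -> cell x i r'.+1 = (i == (c.2.1 r')%:Z)%:R &
    forall q, (q < size code)%N ->
      cell x i (head_track K q) = ((q == c.1) && (i == c.2.2%:Z))%:R].

Hypothesis code_bounded : all (instr_bounded K) code.

Lemma represents_step x c d :
  represents x c -> step code c d -> represents (lpm_map I F x) d.
Proof.
move=> xc cd i.
set w := nbhd x i.
have v0 : (var r 1%N 0).@[w] = 0.
  by rewrite meval_var // addrK; case: (xc i).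
have vreg r' : (r' < K)%N -> (var r 1%N r'.+1).@[w] = (i == (c.2.1 r')%:Z)%:R.
  move=> r'K; rewrite meval_var //; last by rewrite /r; lia.
  by rewrite addrK; case: (xc i) => _ /(_ _ r'K).
have vhead u q : (u < 3)%N -> (q < size code)%N ->
    (var r u (head_track K q)).@[w] = ((q == c.1) && (i + u%:Z - 1 == c.2.2%:Z))%:R.
  move=> u3 qm; rewrite meval_var //; last by rewrite /r /head_track; lia.
  by case: (xc (i + u%:Z - 1)) => _ _ /(_ _ qm).
(* By the one-hot coding, only the term of the current instruction survives in a sum over the
   code. *)
have only_pc (G : nat -> int) : (c.1 < size code)%N ->
    (forall q, (q < size code)%N -> q != c.1 -> G q = 0) ->
    \sum_(q < size code) G q = G c.1.
  move=> pc_lt G0; rewrite (bigD1 (Ordinal pc_lt)) //= big1 ?addr0 // => q qpc.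
  by apply: G0.
have pc_lt : (c.1 < size code)%N by case: cd.
have pc_bd : instr_bounded K (nth noop code c.1).
  by move/all_nthP: code_bounded => /(_ noop _ pc_lt).
have u3 (e : bool) : ((if e then 0%N else 2%N) < 3)%N by case: e.
split.
- by rewrite cell_machine -?/w.
- move=> r' r'K; rewrite cell_machine -?/w; last by rewrite /r; lia.
  rewrite /rule r'K vreg // v0 if_same addr0 only_pc //; last first.
    move=> q qm /negPf q_pc; rewrite /carried_in.
    case: nth => [e [r1|]|] //; case: ifP => // _.
    by rewrite !vhead // q_pc subrr.
  rewrite /carried_in.
  case: cd vhead pc_lt pc_bd {vreg xc v0 only_pc} => [q [r1|] s p qm /= -> /= sr|
    q [r1|] s p qm /= -> /= sr|q r1 a b s p qm /= ->] vhead pc_lt pc_bd; try by rewrite addr0.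
  + rewrite /upd [r' == r1]eq_sym; have [<-|_] := eqVneq r1 r'; last by rewrite addr0.
    rewrite !vhead // eqxx sr; lia.
  rewrite /upd [r' == r1]eq_sym; have [<-|_] := eqVneq r1 r'; last by rewrite addr0.
  rewrite !vhead // eqxx sr; lia.
move=> q' q'm; rewrite cell_machine -?/w; last by rewrite /r /head_track; lia.
have -> j : rule K code j (head_track K q') = j 1%N 0%N *+ (q' == 0)%N +
    \sum_(q < size code) jump K code j q q'.
  rewrite /rule /head_track ltnNge leq_addr /= addKn -{2}[K]addn0 eqn_add2l.
  by case: eqP.
rewrite v0 mul0rn add0r (only_pc (fun q => jump _ _ _ q q')) //; last first.
  move=> q qm /negPf q_pc; rewrite /jump.
  by case: nth => [e c'|r1 a b]; rewrite !vhead // q_pc ?mul0r ?if_same.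
rewrite /jump.
case: cd vhead vreg pc_lt pc_bd {xc v0 only_pc} => [q c' s p qm /= -> /= sr|
  q c' s p qm /= -> /= sr|q r1 a b s p qm /= -> /=] vhead vreg pc_lt pc_bd.
- by case: eqP => // _; rewrite vhead // eqxx; congr (_%:R); lia.
- by case: eqP => // _; rewrite vhead // eqxx; congr (_%:R); lia.
rewrite vhead // vreg // eqxx addrK /=.
(* Away from the head both branches vanish; at the head the marker cell is 1 or 0 and selects the
   branch. *)
case: (i =P p%:Z) => [->|_]; last by rewrite andbF mul0r.
rewrite mul1r andbT eqz_nat [p == _]eq_sym.
by case: (s r1 == p); rewrite ?subrr ?subr0 if_same ?addr0 ?add0r; case: ifP.
Qed.

End Simulation.

(** * Orbits of a single map *)

Lemma orbit1 (I : indexing) (F : lpm) x :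
  lpm_orbit I [:: F] x = [set iter n (lpm_map I F) x | n in setT]%classic.
Proof.
apply/seteqP; split=> [y [w [Fw ->]]|y [n _ <-]].
  elim/last_ind: w Fw => [|w G IHw]; first by exists 0%N.
  rewrite -cats1 => /List.Forall_app[Fw FG]; have [n _ n_eq] := IHw Fw.
  exists n.+1 => //; rewrite foldl_cat /= -n_eq.
  by inversion_clear FG as [|? ? [<-|[]]].
exists (nseq n F); split.
  by elim: n => [|n IHn] /=; constructor=> //; left.
by elim: n => //= n ->; elim: n x => //= n IHn x; rewrite -IHn.
Qed.

Lemma stable_fixed (I : indexing) (F : lpm) x n :
  lpm_map I F (iter n (lpm_map I F) x) = iter n (lpm_map I F) x ->
  lpm_stable I [:: F] x.
Proof.
move=> fixn; have tail k : iter (n + k) (lpm_map I F) x = iter n (lpm_map I F) x.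
  by elim: k => [|k IHk]; rewrite ?addn0 // addnS iterS IHk.
rewrite /lpm_stable orbit1.
apply: (@sub_finite_set _ _ [set iter k (lpm_map I F) x | k in `I_n.+1]%classic).
  move=> _ [k _ <-]; case: (leqP k n) => kn; first by exists k.
  by exists n => //=; rewrite -(subnKC (ltnW kn)) tail.
exact/finite_image/finite_II.
Qed.

(** Each orbit point carries at most one label [k] and every label occurs, so choosing labels maps
    the orbit onto a set containing all natural numbers. *)
Lemma unstable_of_injective (I : indexing) (F : lpm) x (P : nat -> (nat -> int) -> Prop) :
  (forall k, exists n, P k (iter n (lpm_map I F) x)) ->
  (forall y k l, P k y -> P l y -> k = l) -> ~ lpm_stable I [:: F] x.
Proof.
move=> exP P_inj; rewrite /lpm_stable orbit1 => fin.
have /choice[f Pf] y : exists k, (exists l, P l y) -> P k y.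
  by have [[l Pl]|noP] := pselect (exists l, P l y); [exists l | exists 0%N].
apply/infinite_nat/sub_finite_set/(finite_image f fin) => k _.
have [n Pn] := exP k; exists (iter n (lpm_map I F) x); first by exists n.
exact: (P_inj _ _ _ (Pf _ (ex_intro _ k Pn)) Pn).
Qed.

(** * Starting, running and halting the machine *)

Section Run.
Variables (I : indexing) (K : nat) (code : seq instr).

Let F := machine K code.
Notation cell := (cell I K code).
Notation represents := (represents I K code).

Lemma cell_inj x y :
  (forall i j, (j < (K + size code).+1)%N -> cell x i j = cell y i j) -> x = y.
Proof.
move=> xy; apply/funext => n.
rewrite -(idxVK I (K + size code) n); case: (idxV I _ n) => i j.
by have := xy i j (ltn_ord j); rewrite /cell inord_val.
Qed.

Lemma track_ind (P : nat -> Prop) : P 0%N -> (forall r, (r < K)%N -> P r.+1) ->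
  (forall q, (q < size code)%N -> P (head_track K q)) ->
  forall j, (j < (K + size code).+1)%N -> P j.
Proof.
move=> P0 Pr Ph [|j] // j_lt; have [/Pr //|Kj] := ltnP j K.
by rewrite -(subnKC Kj); apply: Ph; lia.
Qed.

(** With no head and no start signal all sums in [rule] vanish, and the markers stay. *)
Lemma represents_halted x c : represents x c -> (size code <= c.1)%N ->
  lpm_map I F x = x.
Proof.
move=> xc c_halt; apply: cell_inj => i j j_lt; rewrite cell_machine //.
set w := @nbhd I K code x i.
have v0 : (var (K + size code) 1 0).@[w] = 0.
  by rewrite meval_var // addrK; case: (xc i).
have vhead u q : (u < 3)%N -> (q < size code)%N ->
    (var (K + size code) u (head_track K q)).@[w] = 0.
  move=> u3 qm; rewrite meval_var //; last by rewrite /head_track; lia.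
  case: (xc (i + u%:Z - 1)) => _ _ /(_ _ qm)->.
  by case: eqP => // q_c; move: qm c_halt; rewrite q_c; lia.
have u3 (e : bool) : ((if e then 0%N else 2%N) < 3)%N by case: e.
move: j j_lt; apply: track_ind => [|r rK|q qm].
- by case: (xc i).
- rewrite /rule rK v0 if_same addr0 big1 ?addr0 => [|q _].
    by rewrite meval_var ?addrK //; lia.
  by rewrite /carried_in; case: nth => // d [r'|] //; rewrite !vhead // subrr if_same.
have [_ _ /(_ q qm)->] := xc i.
rewrite /rule /head_track ltnNge leq_addr /= v0 if_same add0r big1 => [|q' _].
  by case: eqP => // q_c; move: qm c_halt; rewrite q_c; lia.
by rewrite /jump; case: nth => [d c'|r a b]; rewrite !vhead // ?mul0r ?if_same.
Qed.

Definition start_cell (e : nat) (i : int) (h : nat) : int :=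
  ((h == 0%N) && (i == 0) || (h == 1%N) && (i == e%:Z))%:R.

(** The first step turns the start signal into the head and the markers of all registers but 0, at
    the origin. So two nonzero cells suffice whatever [K] is. *)
Lemma represents_start x e : (0 < K)%N ->
  (forall i j, (j < (K + size code).+1)%N -> cell x i j = start_cell e i j) ->
  represents (lpm_map I F x) (0%N, (upd (fun=> 0%N) 0 e, 0%N)).
Proof.
move=> K_gt0 xe i.
set w := @nbhd I K code x i.
have v1 j : (j < (K + size code).+1)%N ->
    (var (K + size code) 1 j).@[w] = start_cell e i j.
  by move=> j_lt; rewrite meval_var // addrK xe.
have vhead u q : (u < 3)%N -> (q < size code)%N ->
    (var (K + size code) u (head_track K q)).@[w] = 0.
  move=> u3 qm; rewrite meval_var ?xe //; try by rewrite /head_track; lia.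
  by rewrite /start_cell /head_track; have -> : ((K + q).+1 == 1%N) = false by lia.
have u3 (b : bool) : ((if b then 0%N else 2%N) < 3)%N by case: b.
split.
- by rewrite cell_machine.
- move=> r rK; rewrite cell_machine; last by lia.
  rewrite /rule rK big1 ?addr0 => [|q _].
    rewrite !v1 //; try lia.
    rewrite /start_cell /= orbF eqSS /upd.
    by case: eqP => _ /=; rewrite ?addr0 ?add0r.
  by rewrite /carried_in; case: nth => // d [r'|] //; rewrite !vhead // subrr if_same.
move=> q qm; rewrite cell_machine; last by rewrite /head_track; lia.
rewrite /rule /head_track ltnNge leq_addr /= big1 ?addr0 => [|q' _].
  by rewrite -{2}[K]addn0 eqn_add2l v1 // /start_cell /= orbF; case: eqP.
by rewrite /jump; case: nth => [d c'|r a b]; rewrite !vhead // ?mul0r ?if_same.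
Qed.

Hypothesis code_bounded : all (instr_bounded K) code.

Lemma represents_steps x c d : represents x c -> steps code c d ->
  exists n, represents (iter n (lpm_map I F) x) d.
Proof.
move=> xc; elim=> [|d' e _ [n xd'] d'e]; first by exists 0%N.
by exists n.+1; apply: represents_step d'e.
Qed.

End Run.

Definition starts_at (I : indexing) (F : lpm) (e : nat) (x : nat -> int) : Prop :=
  forall i j, x (idx I (i, j : 'I_(lpm_r F).+1)) = start_cell e i j.

(* The result y = 0 or 1 is in register 2.  The last two instructions walk to
   position y and then look for the home marker to the right, which succeeds
   at once if y = 0 and never otherwise. *)
Definition halt_if_zero (c : murec 1) : prog :=
  Seq (compile c (fun=> 0%N) 2 3) (Seq (goto 2) (goto 1)).

(** The map is chosen before [e], so that [e] may later be its own code. *)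
Lemma murec_machine (c : murec 1) : exists F : lpm, (0 < lpm_r F)%N /\
  forall I e x, starts_at I F e x ->
    (mr_eval c [tuple e] 0%N -> lpm_stable I [:: F] x) /\
    (mr_eval c [tuple e] 1%N -> ~ lpm_stable I [:: F] x).
Proof.
have [K0 K0P] := ex_prog_bounded (halt_if_zero c).
pose K := K0.+1; set P := halt_if_zero c in K0P *.
have KP : prog_bounded K P by apply: prog_bounded_leq K0P; rewrite /K.
pose code := flatten_prog P 0.
have bounded := flatten_bounded 0 KP; rewrite -/code in bounded.
exists (machine K code); split=> // I e x start.
have {start} xs i j : (j < (K + size code).+1)%N -> cell I K code x i j = start_cell e i j.
  by move=> j_lt; rewrite /cell start inordK.
have x1 := represents_start (ltn0Sn K0) xs.
set F := machine K code; set s := upd _ _ _ in x1.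
have run_c y : mr_eval c [tuple e] y -> exists t, [/\
    run (compile c (fun=> 0%N) 2 3) s t, t 2%N = y & t 1%N = 0%N].
  move=> cy; have [|||||||t [t_run t_y t_ag]] := @compileP _ c (fun=> 0%N) 2 3 s _ y cy => //.
    by move=> i; rewrite (ord1 i).
  by exists t; split=> //; rewrite t_ag.
split=> [/run_c | /run_c][t [t_run t2 t1]].
  have exec_P : exec P (s, 0%N) (t, 0%N).
    apply: exec_seq t_run _; apply: (@exec_seq _ _ _ (t, 0%N)).
      by have := @exec_goto 2 t 0 (leq0n _); rewrite t2.
    by have := @exec_goto 1 t 0 (leq0n _); rewrite t1.
  have [n xn] := represents_steps bounded x1 (flatten_steps exec_P).
  (* The extra iteration is the start step. *)
  apply: (@stable_fixed I F x n.+1).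
  by rewrite iterSr; apply: (represents_halted xn).
have [A [B codeE]] : exists A B, code = A ++ B ++ flatten_prog (goto 1) (size A + size B)
  /\ A = flatten_prog (compile c (fun=> 0%N) 2 3) 0 /\ B = flatten_prog (goto 2) (size A).
  by do 2!eexists; split; last by split; reflexivity.
case: codeE => codeE [AE BE].
(* The result 1 brings the head to position 1, right of the home marker; each turn of the final loop
   (test, move, jump back) then takes it one cell further. *)
have steps_q k : steps code (0%N, (s, 0%N)) ((size A + size B)%N, (t, k.+1)).
  elim: k => [|k IHk].
    apply: (@steps_trans _ _ (size A, (t, 0%N))).
      have := exec_steps t_run (B ++ flatten_prog (goto 1) (size A + size B)) (erefl (size [::])).
      by rewrite /= -AE -codeE.
    have go2 : exec (goto 2) (t, 0%N) (t, 1%N) by have := @exec_goto 2 t 0 (leq0n _); rewrite t2.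
    have := exec_steps go2 (flatten_prog (goto 1) (size A + size B)) (erefl (size A)).
    by rewrite -BE -codeE.
  apply: steps_trans IHk _.
  set q := (size A + size B)%N.
  have lt_q j : (j < 3)%N -> (q + j < size code)%N.
    by move=> j3; rewrite codeE !size_cat /= -/q /q; lia.
  have nth_q j : nth noop code (q + j) = nth noop (flatten_prog (goto 1) q) j.
    by rewrite codeE catA nth_cat size_cat ltnNge leq_addr /= addKn.
  have := @step_test code (q + 0) 1 _ _ t k.+1 (lt_q 0%N isT) (nth_q 0%N).
  rewrite t1 /= addn0 => /step_steps/steps_trans; apply.
  have := @step_right code (q + 1) None t k.+1 (lt_q 1%N isT) (nth_q 1%N) Logic.I.
  rewrite addn1 /= => /step_steps/steps_trans; apply.
  have := @step_test code (q + 2) 1 _ _ t k.+2 (lt_q 2%N isT) (nth_q 2%N).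
  by rewrite t1 /= addn2 => /step_steps.
set q := (size A + size B)%N in steps_q.
have q_lt : (q < size code)%N by rewrite codeE !size_cat /= -/q /q; lia.
apply: (@unstable_of_injective I F x
  (fun k y => represents I K code y (q, (t, k.+1)))).
  move=> k; have [n xn] := represents_steps bounded x1 (steps_q k).
  by exists n.+1; rewrite iterSr.
move=> y k l yk yl.
(* The track of [q] has its only head at [k.+1] by one representation and at [l.+1] by the other. *)
have [_ _ /(_ q q_lt)] := yk k.+1%:Z; have [_ _ /(_ q q_lt)->] := yl k.+1%:Z.
by rewrite !eqxx /=; case: eqP => [[]|].
Qed.

(** * Diagonalization *)

Section StartPoint.
Variable I : indexing.

Definition input_cell (r e : nat) : nat := idx I (e%:Z, inord 1 : 'I_r.+1).

Definition start_index (r : nat) : nat := idx I (0 : int, ord0 : 'I_r.+1).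

Definition start_point (r e : nat) : fs_point :=
  [fsfun n in [fset start_index r; input_cell r e]%fset => 1 | 0].

(** The coordinates must be listed by increasing index, hence the minimum and maximum; 2 is
    [code_int 1]. *)
Definition start_code (r e : nat) : nat :=
  code_seq [:: code_pair (minn (start_index r) (input_cell r e)) 2;
               code_pair (maxn (start_index r) (input_cell r e)) 2].

Lemma start_index_neq r e : (0 < r)%N -> start_index r != input_cell r e.
Proof.
move=> r_gt0; rewrite (can_eq (@idxK I r)) xpair_eqE negb_and; apply/orP; right.
by rewrite -val_eqE /= inordK.
Qed.

Lemma code_start_point r e : (0 < r)%N -> code_fs_point (start_point r e) = start_code r e.
Proof.
move=> r_gt0; have := start_index_neq e r_gt0.
set a := start_index r; set b := input_cell r e => ab.
have supp : finsupp (start_point r e) = [fset a; b]%fset.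
  by rewrite finsupp_fsfun; apply/fsetP => n; rewrite !inE /= andbT.
have sort_supp : sort leq (finsupp (start_point r e)) = [:: minn a b; maxn a b].
  apply: (sorted_eq leq_trans anti_leq).
  - exact/sort_sorted/leq_total.
  - by rewrite /= andbT; lia.
  rewrite perm_sort; apply: uniq_perm; first exact: fset_uniq.
    by rewrite /= andbT inE; lia.
  by move=> n; rewrite supp !inE; lia.
have in_supp n : (n == a) || (n == b) -> start_point r e n = 1.
  by move=> nab; rewrite fsfunE !inE nab.
rewrite /code_fs_point sort_supp /= !in_supp //; lia.
Qed.

Lemma start_point_starts_at F e : (0 < lpm_r F)%N ->
  starts_at I F e (start_point (lpm_r F) e).
Proof.
move=> r_gt0 i j; rewrite fsfunE !inE /start_cell /start_index /input_cell.
rewrite !(can_eq (@idxK I _)) !xpair_eqE -!val_eqE /= inordK //.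
by case: (i == 0); case: (i == e%:Z); case: eqP; case: eqP.
Qed.

Lemma computable_idx n (r x : n.-tuple nat -> nat) (i : nat -> int) (j : forall s, 'I_s.+1) :
  computable r -> computable (fun v => code_int (i (x v))) ->
  computable (fun v => nat_of_ord (j (r v))) ->
  computable (fun v => idx I (i (x v), j (r v))).
Proof.
move=> r_comp [cx xP] [cy yP]; have [cr rP] := computable_S r_comp.
have [c cP] := idx_computable I.
exists (mr_comp c (tnth [tuple cr; cx; cy])) => v.
exists [tuple (r v).+1; code_int (i (x v)); nat_of_ord (j (r v))].
by split=> // -[[|[|[|]]]] //= ?; rewrite !(tnth_nth 0%N) !(tnth_nth cr) /=.
Qed.

(** On the code of a map, [unpair1] gives [lpm_r] plus 1, and [.-2.+1] turns this into [lpm_r] if it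
    is positive. On every input the successor makes track 1 exist. *)
Lemma computable_start_code n (a : n.-tuple nat -> nat) : computable a ->
  computable (fun v => start_code (unpair1 (a v)).-2.+1 (a v)).
Proof.
move=> ca; have const k := computable_const n k.
have cr : computable (fun v => (unpair1 (a v)).-2.+1).
  by apply/computable_S/computable_pred/computable_pred; apply: computable_unpair1.
have cs : computable (fun v => start_index (unpair1 (a v)).-2.+1).
  exact: (@computable_idx _ _ a (fun=> 0) (fun=> ord0) cr (const 0%N) (const 0%N)).
have ci : computable (fun v => input_cell (unpair1 (a v)).-2.+1 (a v)).
  apply: (@computable_idx _ _ a Posz (fun=> inord 1) cr) => /=.
    exact: computable_double.
  apply: computable_ext (const 1%N) => v /=.
  by rewrite inordK.
do ?[apply: computable_S | apply: computable_pair | apply: computable_minn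
    | apply: computable_maxn | apply: const | by []].
Qed.

Lemma singleton_undecidable :
  ~ decidable_problem
      (fun Fx : lpm * fs_point => [tuple code_lpm Fx.1; code_fs_point Fx.2])
      (fun Fx : lpm * fs_point => lpm_stable I [:: Fx.1] Fx.2).
Proof.
case=> c c_dec.
have ce : computable (fun v : 1.-tuple nat => thead v).
  exact: (computable_proj ord0).
have [p pP] := computable_start_code ce; have [q qP] := ce.
have [F [r_gt0 F_sim]] := murec_machine (mr_comp c (tnth [tuple q; p])).
(* Self-reference: the machine built from the decider receives its own code through the start
   point. *)
set e := code_lpm F; set r := lpm_r F in r_gt0 *.
have c_run y : mr_eval c [tuple e; code_fs_point (start_point r e)] y ->
    mr_eval (mr_comp c (tnth [tuple q; p])) [tuple e] y.
  move=> cy; exists [tuple e; start_code r e]; split; last by rewrite -code_start_point.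
  have e1 : unpair1 e = r.+1 by apply: unpair1K.
  have := pP [tuple e]; have := qP [tuple e].
  rewrite /thead (tnth_nth 0%N) /= e1 /= prednK // => qe pe.
  by case=> [[|[|]]] //= ?; rewrite !(tnth_nth 0%N) !(tnth_nth q) /=.
have [halt loop] := F_sim I e _ (start_point_starts_at e r_gt0).
have [stab unstab] := c_dec (F, start_point r e).
have [st|nst] := pselect (lpm_stable I [:: F] (start_point r e)).
  exact: loop (c_run _ (stab st)) st.
exact: nst (halt (c_run _ (unstab nst))).
Qed.

End StartPoint.

(** The code of a one-element list is [(code_pair a 0).+1], a computable function of the code [a] of
    its element, with which the decider is precomposed. *)
Lemma decidable_singleton (I : indexing) :
  decidable_problem
    (fun Sx : seq lpm * fs_point =>
       [tuple code_seq [seq code_lpm F | F <- Sx.1]; code_fs_point Sx.2])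
    (fun Sx : seq lpm * fs_point => lpm_stable I Sx.1 Sx.2) ->
  decidable_problem
    (fun Fx : lpm * fs_point => [tuple code_lpm Fx.1; code_fs_point Fx.2])
    (fun Fx : lpm * fs_point => lpm_stable I [:: Fx.1] Fx.2).
Proof.
case=> c c_dec.
have [p pP] : computable (fun v : 2.-tuple nat => (code_pair (tnth v ord0) 0).+1).
  by apply/computable_S/computable_pair; [apply: computable_proj | apply: computable_const].
have [q qP] := computable_proj (ord_max : 'I_2).
exists (mr_comp c (tnth [tuple p; q])) => -[F x].
have c_run y : mr_eval c [tuple code_seq [:: code_lpm F]; code_fs_point x] y ->
    mr_eval (mr_comp c (tnth [tuple p; q])) [tuple code_lpm F; code_fs_point x] y.
  move=> cy; eexists; split; last exact: cy.
  have := pP [tuple code_lpm F; code_fs_point x].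
  have := qP [tuple code_lpm F; code_fs_point x].
  rewrite !(tnth_nth 0%N) /= => qx px.
  by case=> [[|[|]]] //= ?; rewrite !(tnth_nth 0%N) !(tnth_nth q) /=.
have [stab unstab] := c_dec ([:: F], x).
by split=> [/stab|/unstab] /c_run.
Qed.

Theorem theorem1p2 (I : indexing) :
  ~ decidable_problem
      (fun Sx : seq lpm * fs_point =>
         [tuple code_seq [seq code_lpm F | F <- Sx.1]; code_fs_point Sx.2])
      (fun Sx : seq lpm * fs_point => lpm_stable I Sx.1 Sx.2)
  /\
  ~ decidable_problem
      (fun Fx : lpm * fs_point => [tuple code_lpm Fx.1; code_fs_point Fx.2])
      (fun Fx : lpm * fs_point => lpm_stable I [:: Fx.1] Fx.2).
Proof.
by split=> [/decidable_singleton|]; apply: singleton_undecidable.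
Qed.
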